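(* Let $f = x + b_1 x^2 + b_2 x^3 + \cdots$ be a formal power series (with coefficients in a commutative ring, e.g. $\mathbb{C}$). Define $f^{(0)} = x$ and $f^{(i)} = f(f^{(i-1)})$ for $i>0$ (composition of power series). Define a matrix $c$ by \[ c_{i,j} = [x^{j+1}] f^{(i)} \qquad (i,j \geq 0). \] Then \[ \det \left( (c_{i,j})_{i,j=0}^n\right) = 1!\, 2! \cdots n!\; b_1^{n(n+1)/2} \qquad (n = 0,1,2,\dots). \]
   Context: For a formal power series $g$, $[x^j] g$ denotes the coefficient of $x^j$ in $g$. The iterates $f^{(i)}$ are well defined since $f$ has no constant term. *)

(* Defs.v *)
From HB Require Import structures.
From mathcomp Require Import all_boot all_order all_algebra.

Set Implicit Arguments.
Unset Strict Implicit.
Unset Printing Implicit Defensive.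

Import GRing.Theory.
Local Open Scope ring_scope.

(* A formal power series over R is its sequence of coefficients:              *)
(* [x^n] g is g n.                                                            *)
Definition fps (R : Type) := nat -> R.

Section FormalPowerSeries.
Variable R : comPzRingType.
Implicit Types f g : fps R.

Definition fps_one : fps R := fun n => (n == 0%N)%:R.

Definition fps_X : fps R := fun n => (n == 1%N)%:R.

Definition fps_mul f g : fps R := fun n => \sum_(k < n.+1) f k * g (n - k)%N.

Definition fps_exp g (k : nat) : fps R := iter k (fps_mul g) fps_one.

(* f(g) = \sum_k f_k g^k, for g without constant term. Since g^k then has     *)
(* order at least k, the terms with k > n do not contribute to [x^n] f(g);    *)
(* see fps_comp_trunc. For g 0 != 0 the value is meaningless.                 *)
Definition fps_comp f g : fps R :=
  fun n => \sum_(k < n.+1) f k * fps_exp g k n.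

Definition fps_iter f (i : nat) : fps R := iter i (fps_comp f) fps_X.

Definition iter_coef f (i j : nat) : R := fps_iter f i j.+1.

Lemma fps_exp_small g k n : g 0%N = 0 -> (n < k)%N -> fps_exp g k n = 0.
Proof.
move=> g0; elim: k n => [//|k IHk] n lt_n_k.
apply: big1 => -[[|i] lt_i_n] _ /=; first by rewrite g0 mul0r.
rewrite [X in _ * X]IHk ?mulr0 // ltn_subLR // addSn.
by rewrite (leq_trans lt_n_k) // ltnS leq_addl.
Qed.

Lemma fps_comp_trunc f g n N : g 0%N = 0 -> (n <= N)%N ->
  fps_comp f g n = \sum_(k < N.+1) f k * fps_exp g k n.
Proof.
move=> g0 le_n_N; rewrite /fps_comp.
rewrite (big_ord_widen N.+1 (fun k => f k * fps_exp g k n)) // big_mkcond /=.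
apply: eq_bigr => k _; case: ltnP => // lt_n_k.
by rewrite fps_exp_small ?mulr0.
Qed.

Lemma fps_iter0 f i : f 0%N = 0 -> fps_iter f i 0%N = 0.
Proof.
by move=> f0; case: i => [//|i]; rewrite /fps_iter /= /fps_comp big_ord1 f0 mul0r.
Qed.

End FormalPowerSeries.

(* Main.v *)
Require Import Defs.
From mathcomp Require Import all_boot all_order all_algebra.

Set Implicit Arguments.
Unset Strict Implicit.
Unset Printing Implicit Defensive.

Import GRing.Theory.
Local Open Scope ring_scope.

(* Modulo x^m.+1, let P(g) be the matrix whose k-th row lists the coefficients
   of g^k. Composition of series becomes product of matrices, so the i-th row
   of c is a row of P(f)^i = (1 + N)^i, where N = P(f) - 1 is strictly upper
   triangular with entries k * b_1 just above the diagonal. The binomial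
   formula then writes c as a lower unitriangular matrix of binomial
   coefficients times an upper triangular matrix, with diagonal entries
   k! * b_1^k. *)

Lemma intertwine_exp (A : pzRingType) (x y p : A) k :
  x * p = p * y -> x ^+ k * p = p * y ^+ k.
Proof.
move=> xp; elim: k => [|k IHk]; first by rewrite !expr0 mul1r mulr1.
by rewrite exprSr -mulrA xp mulrA IHk -mulrA -exprSr.
Qed.

(** * Matrices of power series modulo [x^(m+1)] *)

Section Truncation.
Variables (R : comPzRingType) (m : nat).
Implicit Types f g u v : fps R.

(* The matrix of multiplication by u, acting on rows of coefficients. *)
Definition toeplitz u : 'M[R]_m.+1 :=
  \matrix_(i, j) (u (j - i)%N *+ (i <= j)%N).

Definition power_mx g : 'M[R]_m.+1 := \matrix_(k, j) fps_exp g k j.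

Lemma eq_toeplitz u v :
  (forall n, (n <= m)%N -> u n = v n) -> toeplitz u = toeplitz v.
Proof.
move=> uv; apply/matrixP => i j; rewrite !mxE uv //.
by rewrite (leq_trans (leq_subr _ _)) // -ltnS.
Qed.

Lemma toeplitz_one : toeplitz (@fps_one R) = 1.
Proof.
apply/matrixP => i j; rewrite !mxE /fps_one -val_eqE /= subn_eq0.
by case: ltngtP => // ->.
Qed.

Lemma toeplitz_mul u v : toeplitz (fps_mul u v) = toeplitz u * toeplitz v.
Proof.
apply/matrixP => i j; rewrite mxE [RHS]mxE /fps_mul.
pose F k := u (k - i)%N *+ (i <= k)%N * (v (j - k)%N *+ (k <= j)%N).
rewrite [RHS](_ : _ = \sum_(k < m.+1) F k); last first.
  by apply: eq_bigr => k _; rewrite !mxE.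
rewrite -(big_mkord xpredT F); have [le_ij|lt_ji] := leqP i j; last first.
  rewrite mulr0n big1 // => k _; rewrite /F.
  case: (leqP i k) => [le_ik|_]; last by rewrite mulr0n mul0r.
  by rewrite [(k <= j)%N]leqNgt (leq_trans lt_ji le_ik) mulr0n mulr0.
(* Only indices from [i] to [j] contribute; shifting them by [i] gives the convolution. *)
rewrite mulr1n (@big_cat_nat _ _ _ i) //=; last by rewrite ltnW.
rewrite big_nat [X in _ = X + _]big1 ?add0r; last first.
  by move=> k /andP[_ lt_ki]; rewrite /F leqNgt lt_ki mulr0n mul0r.
rewrite (@big_cat_nat _ _ _ j.+1) //=; last by rewrite leqW.
rewrite [X in _ + X]big_nat [X in _ + X]big1 ?addr0; last first.
  by move=> k /andP[lt_jk _]; rewrite /F [(k <= j)%N]leqNgt lt_jk mulr0n mulr0.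
rewrite -[X in index_iota X]add0n big_addn subSn // big_mkord.
apply: eq_bigr => k _; rewrite /F addnK leq_addl mulr1n.
have le_k : (k <= j - i)%N by rewrite -ltnS.
by rewrite addnC subnDA -leq_subRL // le_k mulr1n.
Qed.

Lemma toeplitz_exp g k : toeplitz (fps_exp g k) = toeplitz g ^+ k.
Proof.
by elim: k => [|k IHk]; rewrite ?toeplitz_one // exprS -IHk -toeplitz_mul.
Qed.

(** One bound [m] serves all entries: they involve coefficients up to [x^m] only, to which [g^k]
    with [k > m] does not contribute. *)
Lemma toeplitz_comp f g : g 0%N = 0 ->
  toeplitz (fps_comp f g) = \sum_(k < m.+1) f k *: toeplitz g ^+ k.
Proof.
move=> g0; apply/matrixP => i j; rewrite mxE summxE.
rewrite (@fps_comp_trunc _ f g _ m) //; last first.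
  by rewrite (leq_trans (leq_subr _ _)) // -ltnS.
rewrite -sumrMnl; apply: eq_bigr => k _.
by rewrite -toeplitz_exp !mxE mulrnAr.
Qed.

Lemma fps_mulX u n : fps_mul (@fps_X R) u n = u n.-1 *+ (0 < n)%N.
Proof.
case: n => [|n]; first by rewrite /fps_mul big_ord1 /fps_X mul0r.
rewrite /fps_mul 2!big_ord_recl /= big1 => [|i _]; last by rewrite /fps_X mul0r.
by rewrite /fps_X mul0r mul1r add0r addr0 /bump /= subn1.
Qed.

Lemma fps_expX k n : fps_exp (@fps_X R) k n = (n == k)%:R.
Proof.
elim: k n => // k IHk n; rewrite [LHS]fps_mulX.
by case: n => [|n]; rewrite ?mulr0n ?IHk ?mulr1n.
Qed.

Lemma power_mx_X : power_mx (@fps_X R) = 1.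
Proof. by apply/matrixP => i j; rewrite !mxE fps_expX eq_sym. Qed.

(** This is [toeplitz_comp] applied to [u(x) = u]. *)
Lemma toeplitzE u :
  toeplitz u = \sum_(k < m.+1) u k *: toeplitz (@fps_X R) ^+ k.
Proof.
rewrite -toeplitz_comp //; apply: eq_toeplitz => n _; rewrite /fps_comp.
rewrite big_ord_recr /= big1 ?add0r => [|i _].
  by rewrite fps_expX eqxx mulr1.
by rewrite fps_expX gtn_eqF ?mulr0.
Qed.

Lemma row_power_mx g k : row k (power_mx g) = row 0 (toeplitz g ^+ k).
Proof.
by apply/rowP => j; rewrite -toeplitz_exp !mxE subn0 leq0n mulr1n.
Qed.

(** Row [i] of either side lists [g^(i+1)]: on the left the matrix of [x] shifts the rows of
    [power_mx g] up by one, on the right [g^i] is multiplied by [g]. In the last row both vanish,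
    since [g^(m+1)] has order above [m]. *)
Lemma toeplitz_X_power_mx g : g 0%N = 0 ->
  toeplitz (@fps_X R) * power_mx g = power_mx g * toeplitz g.
Proof.
move=> g0; apply/row_matrixP => i.
rewrite !row_mul row_power_mx -[RHS]row_mul -[LHS]row_mul.
rewrite -[_ *m toeplitz g]exprSr -toeplitz_exp.
apply/rowP => j; rewrite 2![LHS]mxE 2![RHS]mxE subn0 leq0n mulr1n.
under eq_bigr => k _ do rewrite !mxE /fps_X.
have [lt_im|le_mi] := ltnP i m; last first.
  rewrite big1 => [|k _].
    rewrite fps_exp_small //.
    by rewrite ltnS (leq_trans _ le_mi) // -ltnS.
  case: leqP => [le_ik|_]; last by rewrite mulr0n mul0r.
  have -> : (k - i)%N = 0%N.
    by apply/eqP; rewrite subn_eq0 (leq_trans _ le_mi) // -ltnS.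
  by rewrite mul0rn mul0r.
have lt_i1 : (i.+1 < m.+1)%N by [].
rewrite (bigD1 (Ordinal lt_i1)) //= subSnn leqnSn mulr1n mul1r.
rewrite big1 ?addr0 // => k; rewrite -val_eqE /= => neq.
case: leqP => [le_ik|_]; last by rewrite mulr0n mul0r.
case: eqP => [e|_]; last by rewrite mul0rn mul0r.
by move: neq; rewrite -(subnK le_ik) e add1n eqxx.
Qed.

(* Both sides are additive in u, and multiplicativity reduces u = x^k to
   u = x: this says that (x^i u)(g) = g^i u(g). *)
Lemma toeplitz_power_mx u g : g 0%N = 0 ->
  toeplitz u * power_mx g = power_mx g * toeplitz (fps_comp u g).
Proof.
move=> g0; rewrite toeplitzE toeplitz_comp // mulr_suml mulr_sumr.
apply: eq_bigr => k _; rewrite -[LHS]scalemxAl -[RHS]scalemxAr.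
by congr (_ *: _); apply/intertwine_exp/toeplitz_X_power_mx.
Qed.

(** Write [T] for [toeplitz], [P] for [power_mx], and [e] for row 0 of [1], which is row 0 of every
    [P(h)]. Row [k] of the left side is [e T(f(g))^k = e P(g) T(f(g))^k = e T(f)^k P(g)], and
    [e T(f)^k] is row [k] of [P(f)]. *)
Lemma power_mx_comp f g : g 0%N = 0 ->
  power_mx (fps_comp f g) = power_mx f * power_mx g.
Proof.
move=> g0; have row0 h : row 0 (power_mx h) = row 0 1.
  by rewrite row_power_mx expr0.
have comm k := intertwine_exp k (toeplitz_power_mx f g0).
apply/row_matrixP => k; rewrite row_mul !row_power_mx -row_mul.
by rewrite [_ *m _]comm row_mul row0 -row_mul mul1mx.
Qed.

Lemma power_mx_iter f i : f 0%N = 0 ->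
  power_mx (fps_iter f i) = power_mx f ^+ i.
Proof.
move=> f0; elim: i => [|i IHi]; first by rewrite power_mx_X.
by rewrite exprS -IHi -power_mx_comp // fps_iter0.
Qed.

End Truncation.

(** * Lowest coefficients of the powers of a series *)

Lemma fps_exp1 (R : comPzRingType) (g : fps R) n : fps_exp g 1 n = g n.
Proof.
rewrite /fps_exp /= /fps_mul big_ord_recr /= subnn /fps_one mulr1.
rewrite big1 ?add0r // => i _.
by rewrite subn_eq0 leqNgt ltn_ord mulr0.
Qed.

Lemma fps_expS (R : comPzRingType) (g : fps R) k n :
  fps_exp g k.+1 n = \sum_(i < n.+1) g i * fps_exp g k (n - i)%N.
Proof. by []. Qed.

Lemma fps_exp_diag (R : comPzRingType) (f : fps R) k :
  f 0%N = 0 -> f 1%N = 1 -> fps_exp f k k = 1.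
Proof.
move=> f0 f1; elim: k => // k IHk.
rewrite fps_expS 2!big_ord_recl /= f0 mul0r add0r.
rewrite /bump /= f1 mul1r subn1 /= IHk big1 ?addr0 // => i _.
rewrite fps_exp_small ?mulr0 //.
by rewrite !add1n subSS ltn_subLR ?addSn ?ltnS ?leq_addl.
Qed.

(** In the product of [f] and [f^k], the term [x] of [f] passes on the value for [k], the quadratic
    term adds one [f 2], and later terms meet coefficients of [f^k] below its order. *)
Lemma fps_exp_subdiag (R : comPzRingType) (f : fps R) k :
  f 0%N = 0 -> f 1%N = 1 -> fps_exp f k k.+1 = f 2%N *+ k.
Proof.
move=> f0 f1; elim: k => // k IHk.
rewrite fps_expS 3!big_ord_recl /= f0 mul0r add0r.
rewrite /bump /= f1 mul1r subn1 subn2 /= IHk fps_exp_diag //.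
rewrite mulr1 big1 ?addr0 1?mulrSr // => i _.
rewrite fps_exp_small ?mulr0 //.
by rewrite !add1n !subSS ltn_subLR ?addSn ?ltnS ?leq_addl.
Qed.

(** * Powers of the nilpotent part *)

Section NilpotentPowers.
Variables (R : comPzRingType) (m : nat) (f : fps R).
Hypotheses (f0 : f 0%N = 0) (f1 : f 1%N = 1).

Let N : 'M[R]_m.+1 := power_mx m f - 1.

Lemma nilp_le (i j : 'I_m.+1) : (j <= i)%N -> N i j = 0.
Proof.
rewrite !mxE -val_eqE /= leq_eqVlt => /orP[/eqP ->|lt_ji].
  by rewrite fps_exp_diag // eqxx subrr.
by rewrite fps_exp_small // gtn_eqF // subr0.
Qed.

Lemma nilp_super (i j : 'I_m.+1) : j = i.+1 :> nat -> N i j = f 2%N *+ i.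
Proof.
by move=> e; rewrite !mxE -val_eqE /= e ltn_eqF // subr0 fps_exp_subdiag.
Qed.

(** Each factor [N] raises the column index by at least one. *)
Lemma nilp_exp_lt k (i j : 'I_m.+1) : (j < i + k)%N -> (N ^+ k) i j = 0.
Proof.
elim: k j => [|k IHk] j lt_j.
  by rewrite addn0 in lt_j; rewrite expr0 mxE -val_eqE /= gtn_eqF.
rewrite exprSr mxE big1 // => l _.
have [lt_l|le_l] := ltnP l (i + k); first by rewrite IHk // mul0r.
by rewrite nilp_le ?mulr0 // -ltnS (leq_trans lt_j) // addnS ltnS.
Qed.

(** Only the path [1, 2, ..., k+1] along the superdiagonal contributes, with weights
    [f 2, 2 f 2, ..., k f 2]. *)
Lemma nilp_exp_diag k (i j : 'I_m.+1) : i = 1%N :> nat -> j = k.+1 :> nat ->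
  (N ^+ k) i j = k`!%:R * f 2%N ^+ k.
Proof.
move=> i1; elim: k j => [|k IHk] j ej.
  by rewrite expr0 mxE -val_eqE /= i1 ej mulr1.
have lt_k : (k.+1 < m.+1)%N by rewrite ltnW // -ej.
rewrite exprSr mxE (bigD1 (Ordinal lt_k)) //= IHk // nilp_super //=.
rewrite big1 ?addr0 => [|l]; last first.
  rewrite -val_eqE neq_ltn /= => /orP[lt_l|lt_l].
    by rewrite nilp_exp_lt ?mul0r // i1 add1n.
  by rewrite nilp_le ?mulr0 // ej.
by rewrite mulrnAr -mulrA -exprSr factS natrM -[RHS]mulrA [RHS]mulr_natl.
Qed.

End NilpotentPowers.

(** * Binomial factorization and the determinant *)

Theorem theorem2 (R : comPzRingType) (b : nat -> R) (f : fps R)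
    (hf0 : f 0%N = 0) (hf1 : f 1%N = 1)
    (hfb : forall k : nat, (0 < k)%N -> f k.+1 = b k) (n : nat) :
  \det (\matrix_(i < n.+1, j < n.+1) iter_coef f i j) =
    (\prod_(1 <= k < n.+1) k`!)%N%:R * b 1%N ^+ ((n * n.+1) %/ 2)%N.
Proof.
(* Size [n.+2] because column [j] of the target is the coefficient of [x^(j+1)]. Row [one] of
   [power_mx] lists the series itself, and [lift ord0 j] is column [j+1]. *)
pose N : 'M[R]_n.+2 := power_mx n.+1 f - 1.
pose one := lift ord0 ord0 : 'I_n.+2.
pose L : 'M[R]_n.+1 := \matrix_(i, k) 'C(i, k)%:R.
pose U : 'M[R]_n.+1 := \matrix_(k, j) (N ^+ k) one (lift ord0 j).
have -> : \matrix_(i < n.+1, j < n.+1) iter_coef f i j = L *m U.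
  apply/matrixP => i j; rewrite !mxE /iter_coef -fps_exp1.
  have -> : fps_exp (fps_iter f i) 1 j.+1 =
      (power_mx n.+1 (fps_iter f i)) one (lift ord0 j) by rewrite mxE.
  rewrite power_mx_iter // -[power_mx _ f](subrK 1) -/N addrC.
  rewrite exprDn_comm; last exact: commr_sym (commr1 _).
  rewrite summxE.
  pose F k := ((N ^+ k) one (lift ord0 j)) *+ 'C(i, k).
  rewrite (eq_bigr (fun k : 'I_i.+1 => F k)); last first.
    by move=> k _; rewrite expr1n mul1r mulmxnE.
  (* The binomial sum stops at [i]; it extends to [n] because ['C(i, k) = 0] for [k > i]. *)
  rewrite (big_ord_widen n.+1 F) // big_mkcond /=.
  apply: eq_bigr => k _; rewrite !mxE mulr_natl; case: ltnP => // lt_ik.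
  by rewrite bin_small.
rewrite det_mulmx [\det L]det_trig; last first.
  by apply/is_trig_mxP => i j lt_ij; rewrite mxE bin_small.
rewrite big1 ?mul1r => [|i _]; last by rewrite mxE binn.
rewrite -det_tr det_trig; last first.
  by apply/is_trig_mxP => i j lt_ij; rewrite !mxE nilp_exp_lt.
rewrite (eq_bigr (fun i : 'I_n.+1 => i`!%:R * b 1%N ^+ i)); last first.
  by move=> i _; rewrite 2!mxE nilp_exp_diag // hfb.
rewrite big_split /= -natr_prod prodrXr.
rewrite -(big_mkord xpredT factorial) -(big_mkord xpredT id) bin2_sum bin2.
by rewrite big_ltn // fact0 mul1n /= mulnC -divn2.
Qed.
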